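(* Let $\Omega$ be an open bounded subset of $\mathbb{R}^d$. The generalized Sobolev algebra $\mathcal{A}(\mathcal{C},L^\infty(\Omega))$ is partially ordered by the binary relation $$\forall U,V\in\mathcal{A}(\mathcal{C},L^\infty(\Omega)),\quad U\le V\iff \mathcal{P}(U-V)=0.$$
   Context: $\mathbb{K}$ is $\mathbb{R}$ or $\mathbb{C}$. A subset $A\subset\mathbb{K}^{]0,1]}$ is solid if $(s_\varepsilon)_\varepsilon\in A$ and $|t_\varepsilon|\le|s_\varepsilon|$ for each $\varepsilon\in]0,1]$ imply $(t_\varepsilon)_\varepsilon\in A$. Fix a solid subring $A$ of $\mathbb{K}^{]0,1]}$ containing the constant family $(1)_\varepsilon$, and a solid ideal $I_A$ of $A$ such that $\lim_{\varepsilon\to0}r_\varepsilon=0$ for all $(r_\varepsilon)_\varepsilon\in I_A$. Set $\mathcal{C}=A/I_A$, $A^+=\{(r_\varepsilon)_\varepsilon\in A: r_\varepsilon\in\mathbb{R}_+\ \forall\varepsilon\}$ and $I_A^+=\{(r_\varepsilon)_\varepsilon\in I_A: r_\varepsilon\in\mathbb{R}_+\ \forall\varepsilon\}$. For a normed algebra $E$, $\mathcal{A}(\mathcal{C},E)=\mathcal{H}_A(E)/\mathcal{I}_{I_A}(E)$, where $\mathcal{H}_A(E)=\{(u_\varepsilon)_\varepsilon\in E^{]0,1]}:(\|u_\varepsilon\|_E)_\varepsilon\in A^+\}$ and $\mathcal{I}_{I_A}(E)=\{(u_\varepsilon)_\varepsilon\in E^{]0,1]}:(\|u_\varepsilon\|_E)_\varepsilon\in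 I_A^+\}$; $cl(u_\varepsilon)_\varepsilon$ denotes the class of $(u_\varepsilon)_\varepsilon$. Here $E=L^\infty(\Omega)$ (real-valued functions) with its usual norm. The mapping $p:L^\infty(\Omega)\to L^\infty(\Omega)$, $p(u)=u^+=\sup\{u,0\}=\frac12(u+|u|)$, extends to the well-defined mapping $\mathcal{P}:\mathcal{A}(\mathcal{C},L^\infty(\Omega))\to\mathcal{A}(\mathcal{C},L^\infty(\Omega))$, $\mathcal{P}(cl(u_\varepsilon)_\varepsilon)=cl(p(u_\varepsilon))_\varepsilon$. *)

(* Defs.v *)
From HB Require Import structures.
From mathcomp Require Import all_boot all_order all_algebra complex.
From mathcomp Require Import all_classical all_reals all_analysis.
From mathcomp Require Import measurable_realfun ess_sup_inf.

Set Implicit Arguments.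
Unset Strict Implicit.
Unset Printing Implicit Defensive.

Import Order.TTheory GRing.Theory Num.Theory.
Import numFieldNormedType.Exports.

Local Open Scope classical_set_scope.
Local Open Scope ring_scope.
Local Open Scope quotient_scope.

Section lebesgue_tuple.
Variable R : realType.
Local Notation T n := (n.-tuple (measurableTypeR R)).

Definition cons_tuple n (x : measurableTypeR R * T n) : T n.+1 :=
  [tuple of x.1 :: x.2].

Lemma measurable_cons_tuple n : measurable_fun setT (@cons_tuple n).
Proof. exact: measurable_cons. Qed.

Section step.
Variables (n : nat) (mu : {sigma_finite_measure set (T n) -> \bar R}).

Definition lebesgue_tuple_step : set (T n.+1) -> \bar R :=
  pushforward (lebesgue_measure \x mu)%E (@cons_tuple n).

HB.instance Definition _ := Measure.copy lebesgue_tuple_step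
  (@measure_function_pushforward__canonical__measure_function_Measure _ _ _ _ R
     (lebesgue_measure \x mu)%E _ (@measurable_cons_tuple n)).

Let sigma_finite_step : sigma_finite setT lebesgue_tuple_step.
Proof.
pose g (t : T n.+1) : measurableTypeR R * T n := (thead t, [tuple of behead t]).
have mg : measurable_fun setT g.
  apply/measurable_fun_pairP; split.
    exact: measurable_tnth.
  exact: measurable_behead.
have gK : g \o @cons_tuple n = id.
  by apply/funext => -[x t]; congr (_, _); apply/val_inj.
have /sigma_finiteP[F [TF ndF Foo]] := sigma_finiteT (@lebesgue_measure R).
have /sigma_finiteP[G [TG ndG Goo]] := sigma_finiteT mu.
exists (fun i => g @^-1` (F i `*` G i)) => [|i].
  rewrite -preimage_bigcup; apply/esym/seteqP; split=> // t _.
  have [[k _ Fk] [l _ Gl]] : (\bigcup_i F i) (g t).1 /\ (\bigcup_i G i) (g t).2.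
    by rewrite -TF -TG.
  exists (maxn k l) => //; split.
    by move: (g t).1 Fk; exact/subsetPset/ndF/leq_maxl.
  by move: (g t).2 Gl; exact/subsetPset/ndG/leq_maxr.
have [mF muF] := Foo i; have [mG muG] := Goo i; split.
  by rewrite -[X in measurable X]setTI; apply: mg => //; exact: measurableX.
rewrite /lebesgue_tuple_step /pushforward -comp_preimage gK preimage_id.
by rewrite product_measure1E// lte_mul_pinfty// ge0_fin_numE.
Qed.

HB.instance Definition _ := Measure_isSigmaFinite.Build _ _ _
  lebesgue_tuple_step sigma_finite_step.

End step.

(* The n-fold product of the one-dimensional Lebesgue measure. *)
Fixpoint lebesgue_tuple n : {sigma_finite_measure set (T n) -> \bar R} :=
  match n with
  | 0 => \d_[tuple]
  | n.+1 => lebesgue_tuple_step (lebesgue_tuple n)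
  end.

(* R^n with its Borel sigma-algebra. *)
Definition borel_rV n := g_sigma_algebraType (@open 'rV[R]_n).

Definition row_of_tuple n (t : T n) : borel_rV n := \row_i tnth t i.

Lemma measurable_row_of_tuple n : measurable_fun setT (@row_of_tuple n).
Proof.
apply: (@measurability _ _ _ (borel_rV n) _ (@row_of_tuple n) (@open 'rV[R]_n)) => // _ [U oU <-]; rewrite setTI.
pose box (qe : 'rV[rat]_n * rat) : set 'rV[R]_n :=
  [set v | forall i, ball (ratr (qe.1 ord0 i) : R) (ratr qe.2) (v ord0 i)].
have -> : U = \bigcup_qe
    (if `[< box qe `<=` U >] then box qe else set0) :> set 'rV[R]_n.
  apply/seteqP; split=> [v Uv|v [qe _]]; last by case: asboolP => // /[apply].
  have /nbhs_ballP[e /= e0 veU] : nbhs v U by rewrite nbhsE; exists U.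
  have /rat_in_itvoo[r] : 0 < e / 2 by rewrite divr_gt0.
  rewrite in_itv/= => /andP[r0 re].
  have qP i : exists q : rat, ball (ratr q : R) (ratr r) (v ord0 i).
    have : v ord0 i - ratr r < v ord0 i + ratr r.
      by rewrite ltrD2l gtrN.
    move=> /rat_in_itvoo[q]; rewrite in_itv/= => /andP[qr rq]; exists q.
    by rewrite -ball_normE/= ltr_distlC ltrBlDr rq/= -ltrBlDr.
  have [q qv] := choice qP.
  exists (\row_i q i, r) => //=; case: asboolP => [_ i/=|bU]; first by rewrite mxE.
  exfalso; apply: bU => w bw; apply: veU; split => // i j; rewrite ord1.
  have := bw j; rewrite /= mxE => /(ball_triangle (ball_sym (qv j))).
  by apply: le_ball; rewrite (splitr e) lerD// ltW.
rewrite preimage_bigcup; apply: countable_bigcupT_measurable => // qe.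
case: asboolP => _; last by rewrite preimage_set0.
rewrite [X in measurable X](_ : _ =
    \big[setI/setT]_(i < n) ((fun t : T n => tnth t i) @^-1`
       ball (ratr (qe.1 ord0 i) : R) (ratr qe.2))); last first.
  apply/seteqP; split => [t/= bt|t].
    by rewrite -bigcap_seq => i _ /=; have := bt i; rewrite mxE.
  by rewrite -bigcap_seq => bt i; rewrite mxE; apply: bt; rewrite /= mem_index_enum.
apply: bigsetI_measurable => i _; rewrite -[X in measurable X]setTI.
apply: measurable_tnth => //; exact: (@measurable_ball R).
Qed.

Definition lebesgue_rV n : set (borel_rV n) -> \bar R :=
  pushforward (lebesgue_tuple n) (@row_of_tuple n).

HB.instance Definition _ n := Measure.copy (@lebesgue_rV n)
  (@measure_function_pushforward__canonical__measure_function_Measure _ _ _ _ R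
     (lebesgue_tuple n) _ (@measurable_row_of_tuple n)).

Section domain.
Variables (n : nat) (Omega : set 'rV[R]_n) (oOmega : open Omega).

Lemma open_borel_rV : measurable (Omega : set (borel_rV n)).
Proof. exact: sub_sigma_algebra. Qed.

(* Restriction to Omega: two functions on R^n are equal almost everywhere for
   this measure iff they are so on Omega, and its essential suprema are those
   over Omega; L^oo of this measure is thus L^oo(Omega). *)
Definition lebesgue_on : {measure set (borel_rV n) -> \bar R} :=
  mrestr (@lebesgue_rV n) open_borel_rV.

End domain.
End lebesgue_tuple.

Lemma lebesgue_tuple_box (R : realType) n (A : 'I_n -> set (measurableTypeR R)) :
  (forall i, measurable (A i)) ->
  lebesgue_tuple R n [set t | forall i, A i (tnth t i)] =
    (\prod_(i < n) lebesgue_measure (A i))%E.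
Proof.
elim: n A => [|n ih] A mA /=.
  by rewrite big_ord0 diracE mem_set//= => -[].
rewrite big_ord_recl /lebesgue_tuple_step /pushforward.
rewrite (_ : _ @^-1` _ = A ord0 `*` [set t : n.-tuple _ | forall i, A (lift ord0 i) (tnth t i)]).
  rewrite product_measure1E//.
    by congr (_ * _)%E; apply: ih.
  rewrite [X in measurable X](_ : _ =
    \big[setI/setT]_(i < n) ((fun t : n.-tuple (measurableTypeR R) => tnth t i) @^-1` (A (lift ord0 i)))).
    apply: bigsetI_measurable => i _; rewrite -[X in measurable X]setTI.
    by apply: measurable_tnth => //; exact: mA.
  apply/seteqP; split => [t/= bt|t].
    by rewrite -bigcap_seq => i _ /=; have := bt i.
  by rewrite -bigcap_seq => bt i; apply: bt; rewrite /= mem_index_enum.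
apply/seteqP; split => [[x t] /= h|[x t] /= [h1 h2] i].
  split; first exact: (h ord0).
  by move=> i; have := h (lift ord0 i); rewrite tnthS.
by case: (unliftP ord0 i) => [j ->|->] //; rewrite tnthS.
Qed.

Lemma lebesgue_rV_box (R : realType) n (A : 'I_n -> set (measurableTypeR R)) :
  (forall i, measurable (A i)) ->
  lebesgue_rV ([set v : 'rV[R]_n | forall i, A i (v ord0 i)] : set (borel_rV R n))
    = (\prod_(i < n) lebesgue_measure (A i))%E.
Proof.
move=> mA; rewrite -lebesgue_tuple_box//; congr (lebesgue_tuple _ _ _).
by apply/seteqP; split=> t /= h i; have := h i; rewrite mxE.
Qed.

Section Linfty.
Context d (T : measurableType d) (R : realType).
Variable mu : {measure set T -> \bar R}.

Local Notation Linfun := (LfunType mu (leey 1)).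

Let LfunBE (f g : Linfun) x : (f - g) x = f x - g x. Proof. by []. Qed.

Definition ae0 : {pred Linfun} := fun f => `[< f = cst 0 %[ae mu] >].

Let ae0_zmod_closed : zmod_closed ae0.
Proof.
split=> [|f g /asboolP f0 /asboolP g0]; apply/asboolP.
  exact/nearW.
by apply: filterS2 f0 g0 => x f0 g0 xT; rewrite LfunBE f0// g0// subr0.
Qed.
HB.instance Definition _ := GRing.isZmodClosed.Build _ ae0 ae0_zmod_closed.

(* [LspaceType] carries no group structure, so L^oo is taken as the quotient of
   the essentially bounded measurable functions by those that vanish a.e. *)
Definition Linfty : Type := Quotient.quot ae0.
HB.instance Definition _ := GRing.Zmodule.on Linfty.

Definition Linfty_class (f : Linfun) : Linfty := \pi f.

Lemma Linfty_classK (u : Linfty) : Linfty_class (repr u) = u.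
Proof. exact: reprK. Qed.

Lemma Linfty_classB : {morph Linfty_class : f g / f - g}.
Proof. by move=> f g; rewrite /Linfty_class !piE. Qed.

Lemma Linfty_classP (f g : Linfun) :
  Linfty_class f = Linfty_class g <-> f = g %[ae mu].
Proof.
have -> : Linfty_class f = Linfty_class g <-> f - g \in ae0.
  by rewrite Quotient.idealrBE; split=> [/eqP|/eqP].
split=> [/asboolP|] fg; [|apply/asboolP]; apply: filterS fg => x fg xT.
  by apply/eqP; rewrite -subr_eq0 -LfunBE fg.
by rewrite LfunBE fg// subrr.
Qed.

Definition Linfty_norm (u : Linfty) : R :=
  fine ('N[mu]_(+oo%E)[EFin \o repr u])%E.

Lemma Linfty_norm_class (f : Linfun) :
  Linfty_norm (Linfty_class f) = fine ('N[mu]_(+oo%E)[EFin \o f])%E.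
Proof.
have /Linfty_classP rf := Linfty_classK (Linfty_class f).
rewrite /Linfty_norm; congr fine; rewrite unlock; case: ifPn => // _.
by apply: eq_ess_sup; apply: filterS rf => x /= ->.
Qed.

Let Linfty_normD u v : Linfty_norm (u + v) <= Linfty_norm u + Linfty_norm v.
Proof.
rewrite -[u]Linfty_classK -[v]Linfty_classK.
have -> : Linfty_class (repr u) + Linfty_class (repr v) = Linfty_class (repr u + repr v).
  by rewrite /Linfty_class !piE.
by rewrite !Linfty_norm_class; exact: ler_LnormD.
Qed.

Let Linfty_norm_eq0 u : Linfty_norm u = 0 -> u = 0.
Proof.
rewrite -[u]Linfty_classK Linfty_norm_class => /fine_Lnormr_eq0 u0.
rewrite -[0](_ : Linfty_class 0 = _); last by rewrite /Linfty_class !piE.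
exact/Linfty_classP.
Qed.

Let Linfty_normMn u k : Linfty_norm (u *+ k) = Linfty_norm u *+ k.
Proof.
rewrite -[u]Linfty_classK.
have -> : Linfty_class (repr u) *+ k = Linfty_class (repr u *+ k).
  by rewrite /Linfty_class raddfMn.
by rewrite !Linfty_norm_class; exact: Lnormr_natmul.
Qed.

Let Linfty_normN u : Linfty_norm (- u) = Linfty_norm u.
Proof.
rewrite -[u]Linfty_classK.
have -> : - Linfty_class (repr u) = Linfty_class (- repr u).
  by rewrite /Linfty_class raddfN.
by rewrite !Linfty_norm_class; exact: LnormrN.
Qed.

HB.instance Definition _ := Num.Zmodule_isNormed.Build R Linfty
  Linfty_normD Linfty_norm_eq0 Linfty_normMn Linfty_normN.

Section pos_part.
Variable f : Linfun.

HB.instance Definition _ := isMeasurableFun.Build _ _ _ _ (f^\+)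
  (measurable_funrpos (measurable_funPT f)).

Let finite_norm_pos : finite_norm mu +oo%E (f^\+).
Proof.
have := @Lfunction_finite _ _ _ _ _ _ f; rewrite /finite_norm.
apply: le_lt_trans; rewrite unlock; case: ifPn => // _.
apply: le_ess_sup; apply: nearW => x /=.
by rewrite lee_fin /funrpos; case: (leP (f x) 0) => _; rewrite ?normr0.
Qed.

HB.instance Definition _ := isLfunction.Build _ _ _ mu +oo%E (leey 1) (f^\+)
  finite_norm_pos.

Definition Lfun_pos : Linfun := f^\+.
End pos_part.

(* u |-> u^+, computed on a representative; see [Linfty_pos_class]. *)
Definition Linfty_pos (u : Linfty) : Linfty := Linfty_class (Lfun_pos (repr u)).

Lemma Linfty_pos_class (f : Linfun) :
  Linfty_pos (Linfty_class f) = Linfty_class (Lfun_pos f).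
Proof.
apply/Linfty_classP; have /Linfty_classP := Linfty_classK (Linfty_class f).
by apply: filterS => x fE xT; rewrite /= /funrpos fE.
Qed.

Let ler_Linfty_norm (f g : Linfun) : (forall x, `|f x| <= `|g x|) ->
  Linfty_norm (Linfty_class f) <= Linfty_norm (Linfty_class g).
Proof.
move=> fg; rewrite !Linfty_norm_class -lee_fin !finite_norm_fine unlock.
case: ifPn => // _; apply: le_ess_sup; apply: nearW => x /=.
by rewrite lee_fin.
Qed.

Lemma ler_norm_Linfty_pos (u : Linfty) : `|Linfty_pos u| <= `|u|.
Proof.
rewrite -[u]Linfty_classK Linfty_pos_class; apply: ler_Linfty_norm => x /=.
by rewrite /funrpos; case: (leP (repr u x) 0) => _; rewrite ?normr0.
Qed.

Lemma ler_norm_Linfty_posB (u v : Linfty) :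
  `|Linfty_pos u - Linfty_pos v| <= `|u - v|.
Proof.
rewrite -[u]Linfty_classK -[v]Linfty_classK !Linfty_pos_class -!Linfty_classB.
apply: ler_Linfty_norm => x; rewrite !LfunBE /= /funrpos.
have le a b : Num.max a 0 - Num.max b 0 <= `|a - b| :> R.
  rewrite lerBlDr ge_max addr_ge0 ?le_max ?lexx ?orbT ?andbT//.
  by rewrite -[leLHS](subrK b) lerD ?ler_norm// le_max lexx.
by rewrite ler_norml lerNl opprB le andbT distrC le.
Qed.
End Linfty.

Variant scalar_kind := RealScalars | ComplexScalars.

Definition scalar_field (R : realType) (k : scalar_kind) : numFieldType :=
  match k with RealScalars => R | ComplexScalars => R[i] end.

Definition real_scalar (R : realType) (k : scalar_kind) : R -> scalar_field R k :=
  match k with RealScalars => id | ComplexScalars => real_complex R end.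

(* The index set ]0, 1] of the families. *)
Definition unit_itv (R : realType) := {e : R | 0 < e <= 1}.

Section factor_ring.
Variables (R : realType) (k : scalar_kind).
Local Notation K := (scalar_field R k).
Local Notation families := (unit_itv R -> K).

Definition solid (S : {pred families}) :=
  forall s t, s \in S -> (forall e, `|t e| <= `|s e|) -> t \in S.

(* The data (A, I_A) of a ring C = A / I_A.  In the limit, r is extended by 0
   outside ]0, 1]; the values at x > 1 do not affect the filter 0^'+. *)
Record factor_ring := FactorRing {
  fr_ring : {pred families};
  fr_ideal : {pred families};
  fr_ring_solid : solid fr_ring;
  fr_ring_closed : subring_closed fr_ring;
  fr_ideal_solid : solid fr_ideal;
  fr_ideal_sub : {subset fr_ideal <= fr_ring};
  fr_ideal_closed : zmod_closed fr_ideal;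
  fr_ideal_mul : {in fr_ring & fr_ideal, forall a r, a * r \in fr_ideal};
  fr_ideal_cvg0 : forall r, r \in fr_ideal ->
    oapp r 0 (insub x) @[x --> (0 : R)^'+] --> (0 : K)
}.

(* S^+; over R[i], 0 <= z says that z is a nonnegative real. *)
Definition nonneg_part (S : {pred families}) : set families :=
  [set r | r \in S /\ forall e, 0 <= r e].

Lemma real_scalar_ge0 (x : R) : (0 <= real_scalar k x) = (0 <= x).
Proof. by case: k => /=; rewrite ?lecR. Qed.

Lemma ler_real_scalar (x y : R) : (real_scalar k x <= real_scalar k y) = (x <= y).
Proof. by case: k => /=; rewrite ?lecR. Qed.

Lemma real_scalarD (x y : R) :
  real_scalar k (x + y) = real_scalar k x + real_scalar k y.
Proof. by case: k => //=; rewrite rmorphD. Qed.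

Lemma real_scalar0 : real_scalar k (0 : R) = 0.
Proof. by case: k. Qed.

Lemma ge0_norm_real_scalar (x : R) : 0 <= x -> `|real_scalar k x| = real_scalar k x.
Proof. by move=> x0; rewrite ger0_norm// real_scalar_ge0. Qed.

End factor_ring.

Section generalized_algebra.
Variables (R : realType) (k : scalar_kind) (C : factor_ring R k).
Variable E : normedZmodType R.

Definition norm_family (u : unit_itv R -> E) : unit_itv R -> scalar_field R k :=
  fun e => real_scalar k `|u e|.

(* H_A(E) *)
Definition moderate : {pred unit_itv R -> E} :=
  fun u => `[< nonneg_part (fr_ring C) (norm_family u) >].

(* I_{I_A}(E) *)
Definition negligible_family : {pred unit_itv R -> E} :=
  fun u => `[< nonneg_part (fr_ideal C) (norm_family u) >].

Let solid_zmod_closed (S : {pred unit_itv R -> scalar_field R k}) :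
  solid S -> zmod_closed S ->
  zmod_closed (fun u : unit_itv R -> E => `[< nonneg_part S (norm_family u) >]).
Proof.
move=> sS cS.
have [S0 SD] := (cS.1, GRing.zmod_closedD cS).
split=> [|u v /asboolP[uS _] /asboolP[vS _]]; apply/asboolP; split.
- suff -> : norm_family 0 = 0 by [].
  by apply/funext => e; rewrite /norm_family normr0 real_scalar0.
- by move=> e; rewrite real_scalar_ge0.
- apply: (sS (norm_family u + norm_family v)) => [|e]; first exact: SD.2.
  rewrite -[X in _ <= `|X|]real_scalarD !ge0_norm_real_scalar ?addr_ge0//.
  by rewrite ler_real_scalar ler_normB.
- by move=> e; rewrite real_scalar_ge0.
Qed.

Let moderate_zmod_closed : zmod_closed moderate.
Proof.
apply: solid_zmod_closed; first exact: fr_ring_solid.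
exact/GRing.subring_closedB/fr_ring_closed.
Qed.
HB.instance Definition _ := GRing.isZmodClosed.Build _ moderate moderate_zmod_closed.

Record moderate_family := ModerateFamily {
  family :> unit_itv R -> E;
  _ : family \in moderate }.

HB.instance Definition _ := [isSub for family].
HB.instance Definition _ := [Choice of moderate_family by <:].
HB.instance Definition _ := [SubChoice_isSubZmodule of moderate_family by <:].

Definition negligible : {pred moderate_family} :=
  fun u => val u \in negligible_family.

Let negligible_zmod_closed : zmod_closed negligible.
Proof.
have [n0 nB] : zmod_closed negligible_family.
  apply: solid_zmod_closed; first exact: fr_ideal_solid.
  exact: fr_ideal_closed.
by split=> [|u v uN vN]; [exact: n0|exact: nB].
Qed.
HB.instance Definition _ := GRing.isZmodClosed.Build _ negligible negligible_zmod_closed.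

(* A(C, E) = H_A(E) / I_{I_A}(E), as an additive group; neither the quotient set
   nor its subtraction depends on the product of E. *)
Definition generalized : Type := Quotient.quot negligible.
HB.instance Definition _ := GRing.Zmodule.on generalized.

Definition cl (u : moderate_family) : generalized := \pi u.

Lemma clP (u v : moderate_family) : cl u = cl v <->
  (fun e => u e - v e) \in negligible_family.
Proof.
have -> : (fun e => u e - v e) = val (u - v) by [].
by rewrite -[_ \in _]/(u - v \in negligible) Quotient.idealrBE; split=> /eqP.
Qed.

End generalized_algebra.
Arguments moderate {R k} C E.
Arguments negligible_family {R k} C E.

Section positive_part.
Context d (T : measurableType d) (R : realType).
Variables (mu : {measure set T -> \bar R}) (k : scalar_kind).
Variable C : factor_ring R k.

Let moderate_pos (u : moderate_family C (Linfty mu)) :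
  (fun e => Linfty_pos (u e)) \in moderate C (Linfty mu).
Proof.
case: u => u /= /asboolP[uA _]; apply/asboolP; split=> [|e]; last first.
  by rewrite real_scalar_ge0.
apply: (fr_ring_solid uA) => e; rewrite !ge0_norm_real_scalar//.
by rewrite ler_real_scalar ler_norm_Linfty_pos.
Qed.

Definition family_pos (u : moderate_family C (Linfty mu)) :
  moderate_family C (Linfty mu) := ModerateFamily (moderate_pos u).

(* The map P, computed on a representative; it is well defined by
   [generalized_pos_cl]. *)
Definition generalized_pos (U : generalized C (Linfty mu)) :
  generalized C (Linfty mu) := cl (family_pos (repr U)).

Lemma generalized_pos_cl (u : moderate_family C (Linfty mu)) :
  generalized_pos (cl u) = cl (family_pos u).
Proof.
apply/clP; have /clP/asboolP[uI _] : cl (repr (cl u)) = cl u by exact: reprK.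
apply/asboolP; split=> [|e]; last by rewrite real_scalar_ge0.
apply: (fr_ideal_solid uI) => e; rewrite !ge0_norm_real_scalar//.
by rewrite ler_real_scalar ler_norm_Linfty_posB.
Qed.

End positive_part.

(* Main.v *)
Require Import Defs.
From HB Require Import structures.
From mathcomp Require Import all_boot all_order all_algebra.
From mathcomp Require Import all_classical all_reals all_analysis.
From mathcomp Require Import lra.

Import Order.TTheory GRing.Theory Num.Theory.
Import numFieldNormedType.Exports.

Local Open Scope classical_set_scope.
Local Open Scope ring_scope.

(** Everything follows from three identities, true for real numbers and hence in
    L^oo and in A(C, L^oo): [0^+ = 0], [u^+ - (-u)^+ = u] and
    [(- u^+ - v^+)^+ = 0].  If [u^+ = v^+ = 0], the second one gives
    [u + v = - (-u)^+ - (-v)^+], so [(u + v)^+ = 0] by the third; this is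
    transitivity.  If [u^+ = (-u)^+ = 0], then [u = 0]; this is antisymmetry. *)

Section Linfty_pos.
Context d (T : measurableType d) (R : realType).
Variable mu : {measure set T -> \bar R}.
Implicit Types u v : Linfty mu.

Lemma Linfty_class0 : @Linfty_class _ _ _ mu 0 = 0.
Proof. by rewrite -[X in Linfty_class X](subrr 0) Linfty_classB subrr. Qed.

(** The positive part does not increase the norm, so no representative of 0 has to be examined. *)
Lemma Linfty_pos0 : Linfty_pos (0 : Linfty mu) = 0.
Proof.
by apply/eqP; rewrite -normr_le0 (le_trans (ler_norm_Linfty_pos 0)) ?normr0.
Qed.

(** Jordan decomposition: [Linfty_pos (- u)] is the negative part of [u]. The identity holds at
    every point for a representative, by cases on signs. *)
Lemma Linfty_posBN u : Linfty_pos u - Linfty_pos (- u) = u.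
Proof.
rewrite -[u]Linfty_classK; set f := repr u.
(* The opposite is treated as a difference from 0, so that [Linfty_classB] carries it to
   representatives. *)
have -> : - Linfty_class f = Linfty_class (- f).
  by rewrite -[LHS]sub0r -Linfty_class0 -Linfty_classB sub0r.
rewrite !Linfty_pos_class -Linfty_classB; apply/Linfty_classP.
apply: nearW => x _ /=.
change (Num.max (f x) 0 - Num.max (- f x) 0 = f x).
by case: (leP (f x) 0) => fx; case: (leP (- f x) 0) => Nfx; lra.
Qed.

(** On representatives the argument is a sum of two nonpositive functions, so its maximum with 0 is
    0 at every point. *)
Lemma Linfty_pos_oppD u v : Linfty_pos (- Linfty_pos u - Linfty_pos v) = 0.
Proof.
rewrite -[u]Linfty_classK -[v]Linfty_classK; set f := repr u; set g := repr v.
rewrite !Linfty_pos_class -[- Linfty_class _]sub0r -Linfty_class0.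
rewrite -!Linfty_classB Linfty_pos_class; apply/Linfty_classP.
apply: nearW => x _ /=.
change (Num.max (0 - Num.max (f x) 0 - Num.max (g x) 0) 0 = 0).
apply/max_idPr; rewrite sub0r -opprD oppr_le0.
by rewrite addr_ge0 ?le_max ?lexx ?orbT.
Qed.

End Linfty_pos.

Section generalized_pos.
Context d (T : measurableType d) (R : realType).
Variables (mu : {measure set T -> \bar R}) (k : scalar_kind).
Variable C : factor_ring R k.
Implicit Types U V : generalized C (Linfty mu).

Lemma cl_repr U : cl (repr U) = U.
Proof. exact: reprK. Qed.

Lemma clB (u v : moderate_family C (Linfty mu)) : cl (u - v) = cl u - cl v.
Proof. by rewrite /cl !piE. Qed.

Lemma cl0 : cl (0 : moderate_family C (Linfty mu)) = 0.
Proof. by rewrite -[X in cl X](subrr 0) clB subrr. Qed.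

(** This identity and the next two lift from L^oo index by index: the two families are equal for
    every [e], not merely up to a negligible family, hence [congr cl]. *)
Lemma generalized_pos0 : generalized_pos (0 : generalized C (Linfty mu)) = 0.
Proof.
rewrite -cl0 generalized_pos_cl; congr cl; apply/val_inj/funext => e.
exact: Linfty_pos0.
Qed.

Lemma generalized_posBN U : generalized_pos U - generalized_pos (- U) = U.
Proof.
rewrite -[U]cl_repr; set u := repr U.
have -> : - cl u = cl (- u) by rewrite -[LHS]sub0r -cl0 -clB sub0r.
rewrite !generalized_pos_cl -clB; congr cl; apply/val_inj/funext => e.
exact: Linfty_posBN.
Qed.

Lemma generalized_pos_oppD U V :
  generalized_pos (- generalized_pos U - generalized_pos V) = 0.
Proof.
rewrite -[U]cl_repr -[V]cl_repr !generalized_pos_cl -[- cl _]sub0r -cl0 -!clB.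
rewrite generalized_pos_cl; congr cl; apply/val_inj/funext => e.
by rewrite sub0r; exact: Linfty_pos_oppD.
Qed.

Lemma generalized_pos_eq0D U V : generalized_pos U = 0 ->
  generalized_pos V = 0 -> generalized_pos (U + V) = 0.
Proof.
move=> U0 V0; rewrite -(generalized_posBN U) -(generalized_posBN V) U0 V0.
by rewrite !sub0r generalized_pos_oppD.
Qed.

End generalized_pos.

Theorem proposition5 (R : realType) (k : scalar_kind) (C : factor_ring R k)
    (d : nat) (Omega : set 'rV[R]_d)
    (oOmega : open Omega) (bOmega : bounded_set Omega) :
  let le : rel (generalized C (Linfty (lebesgue_on oOmega))) :=
    fun U V => generalized_pos (U - V) == 0 in
  [/\ reflexive le, antisymmetric le & transitive le].
Proof.
rewrite /=; split=> [U|U V /andP[/eqP UV /eqP VU]|V U W /eqP UV /eqP VW].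
- by rewrite subrr generalized_pos0.
- apply/eqP; rewrite -subr_eq0 -[U - V]generalized_posBN.
  by rewrite opprB UV VU subrr.
(* Split [U - W] as [(U - V) + (V - W)]; both summands have zero positive part. *)
- by rewrite -[U](subrK V) -addrA generalized_pos_eq0D.
Qed.
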